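(* For each bridgeless (finite) graph $G$ and each integer $d \ge 1$, the values $\Phi_d^\infty(G)$ and $\Phi_d^1(G)$ are rational numbers.
   Context: For a graph $G=(V,E)$ and an integer $d\ge1$, an $\mathbb{R}^d$-flow on $G$ consists of an orientation of the edges together with a map $\varphi\colon E\to\mathbb{R}^d$ such that at every vertex the sum of the values on incoming edges equals the sum of the values on outgoing edges. For $x=(x_1,\dots,x_d)$, $\|x\|_1=\sum_i|x_i|$ and $\|x\|_\infty=\max_i|x_i|$. For a real $r\ge 2$, a $d$-dimensional Manhattan nowhere-zero $r$-flow ($(r,d)$-MNZF) is an $\mathbb{R}^d$-flow with $1\le\|\varphi(e)\|_1\le r-1$ for every edge $e$; a $d$-dimensional Chebyshev nowhere-zero $r$-flow ($(r,d)$-ChNZF) is an $\mathbb{R}^d$-flow with $1\le\|\varphi(e)\|_\infty\le r-1$ for every edge $e$. Define $\Phi_d^1(G)=\inf\{r : G \text{ has an } (r,d)\text{-MNZF}\}$ and $\Phi_d^\infty(G)=\inf\{r : G\text{ has an }(r,d)\text{-ChNZF}\}$. *)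

(* Defs.v *)
From HB Require Import structures.
From mathcomp Require Import all_boot all_order all_algebra.
From mathcomp Require Import boolp classical_sets reals ereal.

Set Implicit Arguments.
Unset Strict Implicit.
Unset Printing Implicit Defensive.

Import Order.TTheory GRing.Theory Num.Theory.

Local Open Scope ring_scope.

(* Finite undirected graphs; parallel edges and loops are allowed (a loop has
   a single endpoint). *)
Record graph := Graph {
  vertex : finType;
  edge : finType;
  ends : edge -> {set vertex};
  ends_card : forall e, (0 < #|ends e| <= 2)%N
}.

Definition adj_in (G : graph) (F : {set edge G}) : rel (vertex G) :=
  fun u v => [exists e in F, ends e == [set u; v]%SET].

Definition num_components (G : graph) (F : {set edge G}) : nat :=
  n_comp (adj_in F) (vertex G).

Definition bridge (G : graph) (e : edge G) : bool :=
  (num_components [set: edge G]%SET < num_components ([set: edge G] :\ e)%SET)%N.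

Definition bridgeless (G : graph) : Prop := forall e : edge G, ~~ bridge e.

(* [o e] is the pair (tail, head) of the edge [e]. *)
Definition orientation (G : graph) (o : edge G -> vertex G * vertex G) : Prop :=
  forall e, ends e = [set (o e).1; (o e).2]%SET.

Definition is_flow (R : realType) (d : nat) (G : graph)
    (o : edge G -> vertex G * vertex G) (phi : edge G -> 'rV[R]_d) : Prop :=
  orientation o /\
  forall v : vertex G,
    \sum_(e : edge G | (o e).2 == v) phi e =
    \sum_(e : edge G | (o e).1 == v) phi e.

Definition norm1 (R : realType) (d : nat) (x : 'rV[R]_d) : R :=
  \sum_(i < d) `|x ord0 i|.

Definition norm_oo (R : realType) (d : nat) (x : 'rV[R]_d) : R :=
  \big[Num.max/0]_(i < d) `|x ord0 i|.

Definition has_MNZF (R : realType) (r : R) (d : nat) (G : graph) : Prop :=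
  exists (o : edge G -> vertex G * vertex G) (phi : edge G -> 'rV[R]_d),
    is_flow o phi /\ forall e, 1 <= norm1 (phi e) <= r - 1.

Definition has_ChNZF (R : realType) (r : R) (d : nat) (G : graph) : Prop :=
  exists (o : edge G -> vertex G * vertex G) (phi : edge G -> 'rV[R]_d),
    is_flow o phi /\ forall e, 1 <= norm_oo (phi e) <= r - 1.

(* The infima live in the extended reals, so that the infimum over an empty
   set of [r] is +oo rather than a default real. *)
Definition Phi1 (R : realType) (d : nat) (G : graph) : \bar R :=
  ereal_inf [set r%:E | r in [set r : R | 2 <= r /\ has_MNZF r d G]]%classic.

Definition Phi_oo (R : realType) (d : nat) (G : graph) : \bar R :=
  ereal_inf [set r%:E | r in [set r : R | 2 <= r /\ has_ChNZF r d G]]%classic.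

(* Main.v *)
(* For either norm, ||x|| is the maximum of finitely many rational linear
   functionals of x. For a fixed orientation the pairs (phi, r) thus form a
   finite union of polyhedra with rational coefficients. Eliminating the
   coordinates of phi by Fourier-Motzkin leaves a finite union of rational
   polyhedra on the line, bounded below by 2, so its least element is rational
   as soon as the union is not empty.

   It is not empty: an edge e that is not a bridge lies on a cycle, hence some
   real flow does not vanish at e; a generic linear combination of these flows
   vanishes nowhere, and rescaling it gives values of absolute value at least 1. *)

Require Import Defs.
From HB Require Import structures.
From mathcomp Require Import all_boot all_order all_algebra.
From mathcomp Require Import boolp classical_sets reals ereal.
From mathcomp Require Import lra.

Set Implicit Arguments.
Unset Strict Implicit.
Unset Printing Implicit Defensive.

Import Order.TTheory GRing.Theory Num.Theory.

Local Open Scope ring_scope.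

(** * Finite unions of rational polyhedral cones *)

Section Semilinear.
Variable R : realType.
Implicit Types (x y : nat -> R) (n : nat).

(** Assignments are defined on all naturals, so removing a variable does not change their type;
    missing coefficients read as 0. *)
Definition lin n (a : seq rat) x : R := \sum_(i < n) ratr a`_i * x i.

Definition islin n (f : (nat -> R) -> R) : Prop :=
  exists a, forall x, f x = lin n a x.

(** A disjunctive normal form: the outer list is a union, each inner list an intersection of
    homogeneous half-spaces. Constants enter through a variable that is later set to 1. *)
Definition semilin n (P : (nat -> R) -> Prop) : Prop :=
  exists LL : seq (seq (seq rat)), forall x,
    P x <-> exists2 L, L \in LL & forall a, a \in L -> 0 <= lin n a x.

Lemma lin_mkseq n (c : nat -> rat) x :
  lin n (mkseq c n) x = \sum_(i < n) ratr (c i) * x i.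
Proof. by apply: eq_bigr => i _; rewrite nth_mkseq. Qed.

Lemma islin_comb n p q f g : islin n f -> islin n g ->
  islin n (fun x => ratr p * f x + ratr q * g x).
Proof.
move=> [a ha] [b hb]; exists (mkseq (fun i => p * a`_i + q * b`_i) n) => x.
rewrite lin_mkseq ha hb /lin !mulr_sumr -big_split; apply: eq_bigr => i _ /=.
by rewrite rmorphD !rmorphM /= mulrDl !mulrA.
Qed.

Lemma eq_islin n f g : f =1 g -> islin n f -> islin n g.
Proof. by move=> e [a ha]; exists a => x; rewrite -e. Qed.

Lemma islin0 n : islin n (fun=> 0).
Proof.
by exists [::] => x; rewrite /lin big1 // => i _; rewrite nth_nil rmorph0 mul0r.
Qed.

Lemma islin_var n k : (k < n)%N -> islin n (fun x => x k).
Proof.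
move=> kn; exists (mkseq (fun i => (i == k)%:R) n) => x.
rewrite lin_mkseq (bigD1 (Ordinal kn)) //= eqxx rmorph1 mul1r big1 ?addr0 //.
by move=> i; rewrite -val_eqE /= => /negbTE ->; rewrite rmorph0 mul0r.
Qed.

Lemma islinD n f g : islin n f -> islin n g -> islin n (fun x => f x + g x).
Proof.
move=> hf hg; apply: eq_islin (islin_comb 1 1 hf hg) => x.
by rewrite rmorph1 !mul1r.
Qed.

Lemma islinZ n p f : islin n f -> islin n (fun x => ratr p * f x).
Proof.
move=> hf; apply: eq_islin (islin_comb p 0 hf hf) => x.
by rewrite rmorph0 mul0r addr0.
Qed.

Lemma islinB n f g : islin n f -> islin n g -> islin n (fun x => f x - g x).
Proof.
move=> hf hg; apply: eq_islin (islin_comb 1 (-1) hf hg) => x.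
by rewrite rmorphN1 rmorph1 mul1r mulN1r.
Qed.

Lemma islin_sum n (I : Type) (s : seq I) (Q : pred I) (F : I -> (nat -> R) -> R) :
  (forall i, islin n (F i)) -> islin n (fun x => \sum_(i <- s | Q i) F i x).
Proof.
move=> hF; elim: s => [|i s IH].
  by apply: eq_islin (islin0 n) => x; rewrite big_nil.
have [Qi|Qi] := boolP (Q i).
  by apply: eq_islin (islinD (hF i) IH) => x; rewrite big_cons Qi.
by apply: eq_islin IH => x; rewrite big_cons (negbTE Qi).
Qed.

Lemma eq_semilin n P Q : (forall x, P x <-> Q x) -> semilin n P -> semilin n Q.
Proof.
by move=> e [LL h]; exists LL => x; apply: iff_trans (h x); apply: iff_sym.
Qed.

Lemma semilin_ge0 n f : islin n f -> semilin n (fun x => 0 <= f x).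
Proof.
move=> [a ha]; exists [:: [:: a]] => x; rewrite ha; split.
  by move=> h; exists [:: a]; rewrite ?mem_head // => b; rewrite inE => /eqP ->.
by move=> [L]; rewrite inE => /eqP -> h; apply: h; rewrite mem_head.
Qed.

Lemma semilin_le n f g : islin n f -> islin n g -> semilin n (fun x => f x <= g x).
Proof.
move=> hf hg; apply: eq_semilin (semilin_ge0 (islinB hg hf)) => x.
by rewrite subr_ge0.
Qed.

Lemma semilin_const n (Q : Prop) : semilin n (fun=> Q).
Proof.
have [q|q] := pselect Q.
  by exists [:: [::]] => x; split=> // _; exists [::]; rewrite ?mem_head.
by exists [::] => x; split=> // -[].
Qed.

Lemma semilinU n P Q : semilin n P -> semilin n Q -> semilin n (fun x => P x \/ Q x).
Proof.
move=> [A hA] [B hB]; exists (A ++ B) => x; rewrite hA hB; split.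
  by move=> [] [L LA h]; exists L => //; rewrite mem_cat LA ?orbT.
by move=> [L]; rewrite mem_cat => /orP[] LA h; [left|right]; exists L.
Qed.

Lemma semilinI n P Q : semilin n P -> semilin n Q -> semilin n (fun x => P x /\ Q x).
Proof.
(* Intersection distributes over union: one system for each pair of systems. *)
move=> [A hA] [B hB]; exists [seq K ++ L | K <- A, L <- B] => x.
rewrite hA hB; split.
  move=> [[K KA hK] [L LB hL]]; exists (K ++ L); first exact: allpairs_f.
  by move=> a; rewrite mem_cat => /orP[/hK|/hL].
move=> [_ /allpairsP[[K L] /= [KA LB ->]] h]; split.
  by exists K => // a aK; apply: h; rewrite mem_cat aK.
by exists L => // a aL; apply: h; rewrite mem_cat aL orbT.
Qed.

Lemma semilin_eq n f g : islin n f -> islin n g -> semilin n (fun x => f x = g x).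
Proof.
move=> hf hg; apply: eq_semilin (semilinI (semilin_le hf hg) (semilin_le hg hf)).
by move=> x; split=> [[fg gf]|->] //; apply/eqP; rewrite eq_le fg.
Qed.

Lemma semilin_forall n (I : finType) (P : I -> (nat -> R) -> Prop) :
  (forall i, semilin n (P i)) -> semilin n (fun x => forall i, P i x).
Proof.
move=> hP; suff h (s : seq I) : semilin n (fun x => forall i, i \in s -> P i x).
  by apply: eq_semilin (h (enum I)) => x; split=> H i *; apply: H; rewrite mem_enum.
elim: s => [|i s IH]; first by apply: eq_semilin (semilin_const n True).
apply: eq_semilin (semilinI (hP i) IH) => x; split.
  by move=> [Pi Ps] j; rewrite inE => /predU1P[->|/Ps].
by move=> h; split=> [|j js]; apply: h; rewrite inE ?eqxx // js orbT.
Qed.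

Lemma semilin_exists n (I : finType) (P : I -> (nat -> R) -> Prop) :
  (forall i, semilin n (P i)) -> semilin n (fun x => exists i, P i x).
Proof.
move=> hP; suff h (s : seq I) : semilin n (fun x => exists2 i, i \in s & P i x).
  apply: eq_semilin (h (enum I)) => x; split=> [[i _ Pi]|[i Pi]]; exists i => //.
  by rewrite mem_enum.
elim: s => [|i s IH].
  by apply: eq_semilin (semilin_const n False) => x; split=> // -[].
apply: eq_semilin (semilinU (hP i) IH) => x; split.
  move=> [Pi|[j js Pj]]; first by exists i; rewrite ?mem_head.
  by exists j; rewrite // inE js orbT.
by move=> [j]; rewrite inE => /predU1P[->|js] Pj; [left|right; exists j].
Qed.

(** * Fourier-Motzkin elimination *)

Lemma between_seq (l u : seq R) :
  (forall p q, p \in l -> q \in u -> p <= q) ->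
  exists t, (forall p, p \in l -> p <= t) /\ (forall q, q \in u -> t <= q).
Proof.
(* With [l] empty, [t] is the minimum of 0 and [u]; each [p] in [l] then raises it to [max p t],
   which stays below [u]. *)
elim: l => [_|p l IH h].
  elim: u => [|q u [t [_ ht]]]; first by exists 0; split.
  exists (Num.min q t); split=> // q'; rewrite inE => /predU1P[->|/ht] *.
    by rewrite ge_min lexx.
  by rewrite ge_min; apply/orP; right.
have [|t [lt tu]] := IH.
  by move=> p' q p'l; apply: h; rewrite inE p'l orbT.
exists (Num.max p t); split=> [p'|q qu].
  by rewrite inE => /predU1P[->|/lt h']; rewrite le_max ?lexx // h' orbT.
by rewrite ge_max tu // h ?mem_head.
Qed.

Definition upd x n (t : R) : nat -> R := fun i => if i == n then t else x i.

Lemma lin_upd n a x t : lin n.+1 a (upd x n t) = lin n a x + ratr a`_n * t.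
Proof.
rewrite /lin big_ord_recr /= /upd eqxx; congr (_ + _); apply: eq_bigr => i _.
by rewrite (ltn_eqF (ltn_ord i)).
Qed.

(** If [a] has positive and [b] negative coefficient at [n], this is a combination of the rows with
    positive weights in which variable [n] cancels. *)
Definition fm_pair n (a b : seq rat) : seq rat :=
  mkseq (fun i => a`_n * b`_i - b`_n * a`_i) n.

Lemma lin_fm_pair n a b x :
  lin n (fm_pair n a b) x = ratr a`_n * lin n b x - ratr b`_n * lin n a x.
Proof.
rewrite lin_mkseq /lin !mulr_sumr -sumrB; apply: eq_bigr => i _.
by rewrite rmorphB !rmorphM /= mulrBl !mulrA.
Qed.

Definition fm_step n (L : seq (seq rat)) : seq (seq rat) :=
  [seq a <- L | a`_n == 0] ++
  [seq fm_pair n a b | a <- [seq a <- L | 0 < a`_n], b <- [seq b <- L | b`_n < 0]].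

(* Fourier-Motzkin: [a] with positive last coefficient bounds [t] from below
   by [- lin n a x / a`_n], [b] with negative one from above. *)
Lemma fm_stepP n L x :
  (exists t, forall a, a \in L -> 0 <= lin n.+1 a (upd x n t)) <->
  (forall a, a \in fm_step n L -> 0 <= lin n a x).
Proof.
split=> [[t ht] c|h].
  rewrite mem_cat mem_filter => /orP[/andP[/eqP a0 aL]|].
    by have := ht _ aL; rewrite lin_upd a0 rmorph0 mul0r addr0.
  move=> /allpairsP[[a b] /= [+ + ->]]; rewrite !mem_filter.
  move=> /andP[a0 aL] /andP[b0 bL]; rewrite lin_fm_pair.
  have := ht _ aL; have := ht _ bL; rewrite !lin_upd.
  have : 0 < ratr a`_n :> R by rewrite ltr0q.
  have : ratr b`_n < 0 :> R by rewrite ltrq0.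
  by move: (ratr _) (ratr _) (lin _ _ _) (lin _ _ _) => B A lb la *; nra.
pose bd (a : seq rat) := - lin n a x / ratr a`_n.
have [|t [hl hu]] := @between_seq [seq bd a | a <- L & 0 < a`_n]
                                  [seq bd b | b <- L & b`_n < 0].
  move=> _ _ /mapP[a + ->] /mapP[b + ->]; rewrite !mem_filter.
  move=> /andP[a0 aL] /andP[b0 bL].
  have := h (fm_pair n a b); rewrite lin_fm_pair mem_cat => H.
  have {}H : 0 <= ratr a`_n * lin n b x - ratr b`_n * lin n a x.
    by apply: H; apply/orP; right; apply: allpairs_f; rewrite mem_filter ?a0 ?b0.
  have a0' : 0 < ratr a`_n :> R by rewrite ltr0q.
  have b0' : ratr b`_n < 0 :> R by rewrite ltrq0.
  rewrite /bd ler_pdivrMr // mulrAC ler_ndivlMr //.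
  by move: H; move: (ratr _) (ratr _) (lin _ _ _) (lin _ _ _) => *; lra.
exists t => a aL; rewrite lin_upd.
have [a0|a0|a0] := ltgtP a`_n 0.
- have : t <= bd a by apply: hu; apply: map_f; rewrite mem_filter a0.
  by rewrite /bd ler_ndivlMr ?ltrq0 //; lra.
- have : bd a <= t by apply: hl; apply: map_f; rewrite mem_filter a0.
  by rewrite /bd ler_pdivrMr ?ltr0q //; lra.
- rewrite a0 rmorph0 mul0r addr0; apply: h.
  by rewrite mem_cat mem_filter a0 eqxx aL.
Qed.

Lemma semilin_proj1 n P :
  semilin n.+1 P -> semilin n (fun x => exists t, P (upd x n t)).
Proof.
move=> [LL h]; exists (map (fm_step n) LL) => x; split.
  move=> [t /h[L LL_L hL]]; exists (fm_step n L); first exact: map_f.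
  by apply/fm_stepP; exists t.
move=> [_ /mapP[L LL_L ->] /fm_stepP[t ht]]; exists t; apply/h.
by exists L.
Qed.

Definition glue m x y : nat -> R := fun i => if (i < m)%N then x i else y i.

(** Induction on [n], removing the last variable each time. For [n = 0] any tail [y] will do, as
    [lin m] reads only the first [m] coordinates. *)
Lemma semilin_proj m n P :
  semilin (m + n) P -> semilin m (fun x => exists y, P (glue m x y)).
Proof.
elim: n P => [|n IH] P; rewrite ?addn0 ?addnS.
  move=> [LL h]; exists LL => x.
  have E L y : (forall a, a \in L -> 0 <= lin m a (glue m x y)) <->
               (forall a, a \in L -> 0 <= lin m a x).
    split=> H a /H; congr (_ <= _); apply: eq_bigr => i _;
      by rewrite /glue ltn_ord.
  split=> [[y /h[L LL_L /E hL]]|[L LL_L hL]]; first by exists L.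
  by exists x; apply/h; exists L => //; apply/E.
move=> /semilin_proj1/IH; apply: eq_semilin => x; split.
  move=> [y [t Pt]]; exists (upd y (m + n) t); congr P: Pt; apply/funext => i.
  rewrite /glue /upd; case: ltnP => // im; case: eqP => // E.
  by rewrite E ltnNge leq_addr in im.
move=> [y Py]; exists y, (y (m + n)%N); congr P: Py; apply/funext => i.
by rewrite /upd; case: eqP => // ->; rewrite /glue ltnNge leq_addr.
Qed.

(** * Rational least elements of sets on the line *)

Definition rat_min (S : R -> Prop) : Prop :=
  exists q : rat, S (ratr q) /\ forall r, S r -> ratr q <= r.

(** Along [x] each row is an affine inequality in [r] with rational coefficients, so the set is an
    interval, and its left end is rational. *)
Lemma polyhedron_min (L : seq (seq rat)) (x : R -> nat -> R) (p : rat) r0 :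
  (forall r, x r 0%N = 1) -> (forall r, x r 1%N = r) ->
  (forall r, (forall a, a \in L -> 0 <= lin 2 a (x r)) -> ratr p <= r) ->
  (forall a, a \in L -> 0 <= lin 2 a (x r0)) ->
  rat_min (fun r => forall a, a \in L -> 0 <= lin 2 a (x r)).
Proof.
move=> x0 x1 hp h0.
have E a r : lin 2 a (x r) = ratr a`_0 + ratr a`_1 * r.
  by rewrite /lin big_ord_recl big_ord1 /= x0 x1 mulr1.
pose M := [seq - a`_0 / a`_1 | a : seq rat <- L & 0 < a`_1].
(* Starting from [p] covers an empty [M]; since [p] bounds the set from below, [q] stays below all
   its points. *)
pose q := foldr Num.max p M.
have qr r : (forall a, a \in L -> 0 <= lin 2 a (x r)) -> ratr q <= r.
  move=> h; have : {in M, forall m, ratr m <= r}.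
    move=> _ /mapP[a + ->]; rewrite mem_filter => /andP[a0 /h].
    rewrite E rmorphM rmorphN fmorphV /= ler_pdivrMr ?ltr0q //; lra.
  rewrite /q; elim: (M) => [_|m s IH hs] /=; first exact: hp.
  rewrite maxEle; case: ifP => _; last by apply: hs; rewrite mem_head.
  by apply: IH => k ks; apply: hs; rewrite inE ks orbT.
have qM m : m \in M -> m <= q.
  rewrite /q; elim: (M) => //= k s IH; rewrite inE le_max => /predU1P[->|/IH ->].
    by rewrite lexx.
  by rewrite orbT.
exists q; split=> // a aL; have := h0 a aL; rewrite !E.
have qr0 := qr _ h0.
(* A row of negative slope holds at [r0], hence at [q <= r0]; one of positive slope holds because
   [q] is at least its bound in [M]. *)
have [a1|a1|->] := ltgtP a`_1 0; last by rewrite rmorph0 !mul0r.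
  have : ratr a`_1 < 0 :> R by rewrite ltrq0.
  by move: qr0; move: (ratr _) (ratr _) (ratr _) => *; nra.
move=> _; have : - a`_0 / a`_1 <= q.
  by apply: qM; apply/mapP; exists a => //; rewrite mem_filter a1.
rewrite ler_pdivrMr // -(ler_rat R) rmorphN rmorphM /=; lra.
Qed.

(** The least of the minima of the nonempty members; empty members are discarded by a classical case
    distinction. *)
Lemma rat_min_union (I : eqType) (s : seq I) (S : I -> R -> Prop) r :
  (forall i t, i \in s -> S i t -> rat_min (S i)) ->
  (exists2 i, i \in s & S i r) -> rat_min (fun t => exists2 i, i \in s & S i t).
Proof.
elim: s r => [|i s IH] r hS; first by case.
move=> exr; have {}IH t : (exists2 j, j \in s & S j t) ->
    rat_min (fun t => exists2 j, j \in s & S j t).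
  by apply: IH => j t' js; apply: hS; rewrite inE js orbT.
have {}hS t : S i t -> rat_min (S i) by apply: hS; rewrite mem_head.
have split_cons t : (exists2 j, j \in i :: s & S j t) <->
    S i t \/ exists2 j, j \in s & S j t.
  split=> [[j]|[Si|[j js Sj]]].
  - by rewrite inE => /predU1P[->|js] Sj; [left|right; exists j].
  - by exists i; rewrite ?mem_head.
  - by exists j; rewrite // inE js orbT.
have [[t /hS[p [Sp pmin]]]|nSi] := pselect (exists t, S i t); last first.
  move: exr => /split_cons[Si|/IH[q [Sq qmin]]]; first by case: nSi; exists r.
  exists q; split=> [|t /split_cons[Si|/qmin //]]; first by apply/split_cons; right.
  by case: nSi; exists t.
have [[t' /IH[q [Sq qmin]]]|nSs] := pselect (exists t, exists2 j, j \in s & S j t).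
  exists (Num.min p q); split=> [|u /split_cons[/pmin pu|/qmin qu]].
  - by apply/split_cons; rewrite minEle; case: ifP => _; [left|right].
  - by apply: le_trans pu; rewrite ler_rat ge_min lexx.
  - by apply: le_trans qu; rewrite ler_rat ge_min lexx orbT.
exists p; split=> [|u /split_cons[/pmin //|Ss]]; first by apply/split_cons; left.
by case: nSs; exists u.
Qed.

Lemma semilin_min (P : (nat -> R) -> Prop) (x : R -> nat -> R) (p : rat) r0 :
  (forall r, x r 0%N = 1) -> (forall r, x r 1%N = r) ->
  semilin 2 P -> (forall r, P (x r) -> ratr p <= r) -> P (x r0) ->
  rat_min (fun r => P (x r)).
Proof.
move=> x0 x1 [LL h] hp /h h0.
have [L t LLL hL|q [/h Pq qmin]] := @rat_min_union _ LL
    (fun L r => forall a, a \in L -> 0 <= lin 2 a (x r)) r0 _ h0.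
  by apply: polyhedron_min hL => // r hr; apply: hp; apply/h; exists L.
by exists q; split=> // r /h; apply: qmin.
Qed.

End Semilinear.

(** * Nowhere-zero real flows on bridgeless graphs *)

Section NowhereZero.
Variables (R : realType) (G : graph).
Implicit Types (o : edge G -> vertex G * vertex G) (f g : edge G -> R).

Lemma ex_orientation : exists o, orientation (G := G) o.
Proof.
have h (e : edge G) : exists p : vertex G * vertex G, ends e = [set p.1; p.2]%SET.
  have := ends_card e; case E : #|ends e| => [|[|[|n]]] // _.
    by have /eqP/cards1P[a ->] := E; exists (a, a); rewrite /= finset.setUid.
  by have /eqP/cards2P[a [b [_ ->]]] := E; exists (a, b).
by have [o ho] := choice h; exists o.
Qed.

Lemma set2_eq (T : finType) (a b u w : T) : [set a; b]%SET = [set u; w]%SET ->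
  (a = u /\ b = w) \/ (a = w /\ b = u).
Proof.
move=> /setP E; have := E a; rewrite !inE eqxx => /esym/orP[]/eqP ?; subst a.
  left; split=> //; have := E b; rewrite !inE eqxx orbT => /esym/orP[]/eqP // bu.
  by have := E w; rewrite !inE eqxx orbT bu orbb => /eqP.
right; split=> //; have := E b; rewrite !inE eqxx orbT => /esym/orP[]/eqP // bw.
by have := E u; rewrite !inE eqxx bw orbb => /eqP.
Qed.

(** Inflow minus outflow in a form linear in [f]: flows are the kernel, and loops contribute 0. *)
Definition net o f (w : vertex G) : R :=
  \sum_e f e * (((o e).2 == w)%:R - ((o e).1 == w)%:R).

Lemma netE o f w :
  net o f w = \sum_(e | (o e).2 == w) f e - \sum_(e | (o e).1 == w) f e.
Proof.
rewrite [X in _ = X - _]big_mkcond [X in _ = _ - X]big_mkcond -sumrB.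
apply: eq_bigr => e _.
by rewrite mulrBr !mulr_natr !mulrb.
Qed.

Lemma net_comb o a f g w :
  net o (fun e => f e + a * g e) w = net o f w + a * net o g w.
Proof.
rewrite /net mulr_sumr -big_split; apply: eq_bigr => e _ /=.
by rewrite mulrDl mulrA.
Qed.

Lemma net_single o e0 w :
  net o (fun e => (e == e0)%:R) w = ((o e0).2 == w)%:R - ((o e0).1 == w)%:R.
Proof.
rewrite /net (bigD1 e0) //= eqxx mul1r big1 ?addr0 // => e /negbTE ->.
by rewrite mul0r.
Qed.

(** Send one unit along a path from [u] to [v] in [F], with sign [s = -1] on an edge traversed
    against its orientation. *)
Lemma connect_net o (F : {set edge G}) u v :
  orientation o -> connect (adj_in F) u v ->
  exists f, (forall e, e \notin F -> f e = 0) /\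
            forall w, net o f w = (v == w)%:R - (u == w)%:R.
Proof.
move=> ho /connectP[p]; elim: p u => [|u' p IH] u /=.
  move=> _ ->; exists (fun=> 0); split=> // w; rewrite subrr /net.
  by rewrite big1 // => e _; rewrite mul0r.
move=> /andP[/exists_inP[e eF /eqP he] pp] lv; have [f [fF fn]] := IH _ pp lv.
have [s hs] : exists s : R, forall w,
    s * (((o e).2 == w)%:R - ((o e).1 == w)%:R) = (u' == w)%:R - (u == w)%:R.
  have [[-> ->]|[-> ->]] := set2_eq (etrans (esym (ho e)) he).
    by exists 1 => w; rewrite mul1r.
  by exists (-1) => w; rewrite mulN1r opprB.
exists (fun e' => f e' + s * (e' == e)%:R); split=> [e' e'F|w].
  by rewrite fF // (_ : e' == e = false) ?mulr0 ?addr0 //; apply: contraNF e'F => /eqP ->.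
by rewrite net_comb net_single hs fn addrA subrK.
Qed.

Lemma adj_in_sym (F : {set edge G}) : symmetric (adj_in F).
Proof.
by move=> u v; rewrite /adj_in; apply: eq_existsb => e; rewrite finset.setUC.
Qed.

(** Contrapositive: if deleting [e] separates its ends, two components of the smaller graph merge
    when [e] is restored, so the deletion increases their number. *)
Lemma nonbridge_connect o e : orientation o -> ~~ bridge e ->
  connect (adj_in ([set: edge G] :\ e)%SET) (o e).1 (o e).2.
Proof.
move=> ho; apply: contraNT; rewrite /bridge /num_components.
set A := adj_in [set: edge G]%SET; set B := adj_in _ => nc.
have sB : connect_sym B by apply: sym_connect_sym; apply: adj_in_sym.
have sA : connect_sym A by apply: sym_connect_sym; apply: adj_in_sym.
have BA : subrel (connect B) (connect A).
  apply: connect_sub => u v /exists_inP[e' _ h]; apply: connect1.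
  by apply/exists_inP; exists e'; rewrite ?inE.
set u := (o e).1 in nc *; set v := (o e).2 in nc *.
have Auv : connect A u v.
  by apply: connect1; apply/exists_inP; exists e; rewrite ?inE // ho.
have rA x : fingraph.root A (fingraph.root B x) = fingraph.root A x.
  by apply/eqP; rewrite root_connect // sA; apply: BA; apply: connect_root.
have nE D : n_comp D (vertex G) = #|[set x | roots D x]%SET|.
  by apply: eq_card => x; rewrite !inE andbT.
rewrite !nE; set SB := [set x | roots B x]%SET.
have vB : fingraph.root B v \in SB by rewrite inE roots_root.
(* Every component of [A] is hit by a root of [B] other than that of [v]: the root of [u] replaces
   it, as both lie in one component of [A]. *)
rewrite [leqRHS](cardsD1 (fingraph.root B v)) vB add1n ltnS.
apply: leq_trans (leq_imset_card (fingraph.root A) _); apply: subset_leq_card.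
apply/fintype.subsetP => x; rewrite inE => /eqP rx; apply/imsetP.
have [xv|xv] := eqVneq (fingraph.root B x) (fingraph.root B v); last first.
  by exists (fingraph.root B x); rewrite ?rA // !inE xv roots_root.
exists (fingraph.root B u); first by rewrite !inE root_connect // nc roots_root.
rewrite rA -rx -(rA x) xv rA; apply/esym/eqP.
by rewrite root_connect.
Qed.

(** Close the path from tail to head that avoids [e] by going back along [e], which then carries
    -1. *)
Lemma nonbridge_flow o e : orientation o -> ~~ bridge e ->
  exists f, (forall w, net o f w = 0) /\ f e != 0.
Proof.
move=> ho /(nonbridge_connect ho)/(connect_net ho)[f [f0 fn]].
exists (fun e' => f e' + (-1) * (e' == e)%:R); split=> [w|].
  by rewrite net_comb net_single fn mulN1r subrr.
by rewrite f0 ?inE ?eqxx // add0r mulr1 oppr_eq0 oner_eq0.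
Qed.

Lemma notin_seq (s : seq R) : exists t, t \notin s.
Proof.
exists (1 + \sum_(y <- s) `|y|); apply/negP => h.
have : \sum_(y <- s) `|y| >= `|1 + \sum_(y <- s) `|y| |.
  by rewrite [leRHS](big_rem _ h) /= lerDl sumr_ge0.
have : 0 <= \sum_(y <- s) `|y| by rewrite sumr_ge0.
by move: (\sum_(y <- s) _) => z z0; rewrite ger0_norm; lra.
Qed.

(** One edge at a time: add [t * g] with [g] a flow nonzero at the new edge and [t] outside the
    finitely many ratios that would create a zero. *)
Lemma nowhere_zero_flow o : orientation o -> bridgeless G ->
  exists f, (forall w, net o f w = 0) /\ forall e, f e != 0.
Proof.
move=> ho hG.
suff h (s : seq (edge G)) : exists f, (forall w, net o f w = 0) /\
    forall e, e \in s -> f e != 0.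
  by have [f [fn fe]] := h (enum (edge G)); exists f; split=> // e; rewrite fe ?mem_enum.
elim: s => [|e s [f [fn fs]]].
  by exists (fun=> 0); split=> // w; rewrite /net big1 // => e _; rewrite mul0r.
have [g [gn ge]] := nonbridge_flow ho (hG e).
have [t ht] := notin_seq [seq - f e' / g e' | e' <- e :: s].
exists (fun e' => f e' + t * g e'); split=> [w|e' e's].
  by rewrite net_comb fn gn mulr0 addr0.
(* Where [g] vanishes the edge is not [e], so [f] is already nonzero there. *)
have [g0|g0] := eqVneq (g e') 0.
  rewrite g0 mulr0 addr0; apply: fs; move: e's; rewrite inE => /predU1P[E|//].
  by rewrite -E g0 eqxx in ge.
apply: contraNneq ht => E; apply/mapP; exists e' => //.
by apply: (canRL (mulfK g0)); apply/eqP; rewrite -addr_eq0 addrC E.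
Qed.

Lemma nowhere_zero_flow_ge1 o : orientation o -> bridgeless G ->
  exists f, (forall w, net o f w = 0) /\ forall e, 1 <= `|f e|.
Proof.
move=> ho hG; have [f [fn f0]] := nowhere_zero_flow ho hG.
(* A single factor that is at least the inverse of every [|f e|]. *)
pose c := \sum_e `|f e|^-1.
have c0 : 0 <= c by apply: sumr_ge0 => e _; rewrite invr_ge0.
exists (fun e => 0 + c * f e); split=> [w|e].
  by rewrite net_comb fn /net big1 ?mulr0 ?addr0 // => e _; rewrite mul0r.
rewrite add0r normrM (ger0_norm c0) -ler_pdivrMr ?normr_gt0 // mul1r.
by rewrite /c (bigD1 e) //= lerDl sumr_ge0 // => e' _; rewrite invr_ge0.
Qed.

End NowhereZero.

(* [N] is the maximum of 0 and of the functionals with coefficients [c k]. *)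
Definition polyhedral (R : realType) d (N : 'rV[R]_d -> R) : Prop :=
  exists (K : finType) (c : K -> 'I_d -> rat),
    (forall x, 1 <= N x <-> exists k, 1 <= \sum_i ratr (c k i) * x ord0 i) /\
    (forall x b, 0 <= b ->
       (N x <= b <-> forall k, \sum_i ratr (c k i) * x ord0 i <= b)).

(** * Both norms as maxima of rational functionals *)

Lemma polyhedral_norm1 (R : realType) d : polyhedral (@norm1 R d).
Proof.
(* One functional per sign vector; the maximum is attained at the signs of [x]. *)
exists {ffun 'I_d -> bool}, (fun (s : {ffun _ -> bool}) i => (-1) ^+ s i).
have le (s : {ffun _ -> bool}) (x : 'rV[R]_d) : \sum_i ratr ((-1) ^+ s i) * x ord0 i <= norm1 x.
  apply: ler_sum => i _; rewrite (le_trans (ler_norm _)) // normrM.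
  by rewrite rmorphXn rmorphN1 normrX normrN1 expr1n mul1r.
have eq (x : 'rV[R]_d) : norm1 x =
    \sum_i ratr ((-1) ^+ [ffun i => x ord0 i < 0] i) * x ord0 i.
  apply: eq_bigr => i _; rewrite ffunE rmorphXn rmorphN1.
  have [h|h] := ltP (x ord0 i) 0; first by rewrite expr1 mulN1r ltr0_norm.
  by rewrite expr0 mul1r ger0_norm.
split=> [x|x b b0]; split.
- by rewrite eq => h; eexists; exact: h.
- by move=> [s h]; apply: le_trans h (le _ _).
- by move=> h s; apply: le_trans (le _ _) h.
- by move=> h; rewrite eq.
Qed.

Lemma polyhedral_norm_oo (R : realType) d : polyhedral (@norm_oo R d).
Proof.
(* The functionals are the coordinates and their negatives. *)
exists ('I_d * bool)%type, (fun (k : _ * bool) i => (-1) ^+ k.2 *+ (i == k.1)).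
have E (x : 'rV[R]_d) (k : _ * bool) :
    \sum_i ratr ((-1) ^+ k.2 *+ (i == k.1)) * x ord0 i = (-1) ^+ k.2 * x ord0 k.1.
  rewrite (bigD1 k.1) //= eqxx mulr1n rmorphXn rmorphN1 big1 ?addr0 //.
  by move=> i /negbTE ->; rewrite mulr0n rmorph0 mul0r.
have nle (x : 'rV[R]_d) b : 0 <= b ->
    (norm_oo x <= b <-> forall i, `|x ord0 i| <= b).
  move=> b0; split=> [h i|h]; last by apply: bigmax_le.
  by apply: le_trans h; apply: le_bigmax.
split=> [x|x b b0].
  split=> [h|[k]].
    have [[i hi]|nex] := pselect (exists i, 1 <= `|x ord0 i|).
      exists (i, x ord0 i < 0); rewrite E /=; move: hi.
      have [h0|h0] := ltP (x ord0 i) 0; first by rewrite mulN1r ltr0_norm.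
      by rewrite mul1r ger0_norm.
    (* All coordinates, and the default 0 of the maximum, are then below 1. *)
    exfalso; move: h; apply/negP; rewrite -ltNge; apply: bigmax_lt => // i _.
    by rewrite ltNge; apply/negP => hi; apply: nex; exists i.
  rewrite E => h; apply: le_trans h (le_trans (ler_norm _) _).
  rewrite normrM normrX normrN1 expr1n mul1r.
  exact: le_bigmax.
rewrite nle //; split=> [h k|h i].
  rewrite E; apply: le_trans (ler_norm _) _.
  by rewrite normrM normrX normrN1 expr1n mul1r.
have := h (i, true); have := h (i, false); rewrite !E /= mul1r mulN1r ler_norml => h1 h2.
by rewrite h1 andbT; lra.
Qed.

(** * Rationality of the infimum for a polyhedral norm *)

Section Rational.
Variables (R : realType) (G : graph) (d : nat) (N : 'rV[R]_d -> R).

(** Common form of [has_MNZF] and [has_ChNZF], with the norm as a parameter. *)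
Definition has_NZF (r : R) : Prop :=
  exists (o : edge G -> vertex G * vertex G) (phi : edge G -> 'rV[R]_d),
    is_flow o phi /\ forall e, 1 <= N (phi e) <= r - 1.

Let n := #|{: edge G * 'I_d}|.
Let idx (e : edge G) (i : 'I_d) : nat := (2 + enum_rank (e, i))%N.

Definition vec_of (x : nat -> R) e : 'rV[R]_d := \row_i x (idx e i).

Lemma vec_of_surj (phi : edge G -> 'rV[R]_d) : exists y, vec_of y = phi.
Proof.
(* Decodes [idx]. The truncated [j - 2] gives arbitrary values at 0 and 1, which [vec_of] never
   reads. *)
exists (fun j => if insub (j - 2)%N is Some k
          then let p := enum_val (k : 'I_n) in phi p.1 ord0 p.2 else 0).
apply/funext => e; apply/rowP => i; rewrite mxE /idx addKn.
by rewrite insubT // => lt; rewrite (_ : Sub _ _ = enum_rank (e, i)) ?enum_rankK //; apply: val_inj.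
Qed.

Lemma islin_vec_of e i : islin (2 + n) (fun x => vec_of x e ord0 i).
Proof.
apply: eq_islin (@islin_var R (2 + n) (idx e i) _) => [x|]; first by rewrite mxE.
by rewrite ltn_add2l.
Qed.

Hypothesis polyN : polyhedral N.

(* Variable 0 stands for the constant 1, variable 1 for [r], and the others
   are the coordinates of the flow. *)
Let coord (r : R) (k : nat) : R := if k == 0%N then 1 else r.

(** Orientations, vertices and functionals are finite in number, so [Q] describes the pairs of flow
    and [r] semilinearly; the flow coordinates are then projected out. *)
Lemma semilin_NZF : exists2 P, semilin 2 P &
  forall r, P (coord r) <-> 2 <= r /\ has_NZF r.
Proof.
have [K [c [N1 Nb]]] := polyN.
pose F k e x : R := \sum_i ratr (c k i) * vec_of x e ord0 i.
have lF k e : islin (2 + n) (F k e).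
  by apply: islin_sum => i; apply: islinZ; apply: islin_vec_of.
have l0 : islin (2 + n) (fun x : nat -> R => x 0%N) by apply: islin_var.
have l1 : islin (2 + n) (fun x : nat -> R => x 1%N) by apply: islin_var.
(* Homogenized with [x 0 = 1]: [x 0 + x 0] is 2 and [x 1 - x 0] is [r - 1]. Orientations are finite
   functions in order to form a [finType]. *)
pose Q (x : nat -> R) := x 0%N + x 0%N <= x 1%N /\
  exists o : {ffun edge G -> vertex G * vertex G}, orientation o /\
  ((forall v i, \sum_(e | (o e).2 == v) vec_of x e ord0 i =
                \sum_(e | (o e).1 == v) vec_of x e ord0 i) /\
   (forall e, (exists k, x 0%N <= F k e x) /\
              (forall k, F k e x <= x 1%N - x 0%N))).
have sQ : semilin (2 + n) Q.
  apply: semilinI; first by apply: semilin_le => //; apply: islinD.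
  apply: semilin_exists => o; apply: semilinI; first exact: semilin_const.
  apply: semilinI.
    apply: semilin_forall => v; apply: semilin_forall => i.
    by apply: semilin_eq; apply: islin_sum => e; apply: islin_vec_of.
  apply: semilin_forall => e; apply: semilinI.
    by apply: semilin_exists => k; apply: semilin_le.
  by apply: semilin_forall => k; apply: semilin_le => //; apply: islinB.
exists (fun x => exists y, Q (glue 2 x y)); first exact: semilin_proj sQ.
have vglue x y : vec_of (glue 2 x y) = vec_of y.
  by apply/funext => e; apply/rowP => i; rewrite !mxE.
move=> r; split.
  move=> [y [/= r2 [o [ho [fl hN]]]]]; rewrite /glue /coord /= in r2 hN.
  split; first by lra.
  exists o, (vec_of y); split.
    split=> // v; apply/rowP => i; rewrite !summxE; have := fl v i.
    by rewrite !vglue.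
  move=> e; have [ex al] := hN e; apply/andP; split.
    by apply/N1; have [k hk] := ex; exists k; rewrite /F vglue in hk.
  by apply/Nb; [lra|move=> k; have := al k; rewrite /F vglue].
move=> [r2 [o [phi [[ho fl] hN]]]]; have [y hy] := vec_of_surj phi.
exists y; split; first by rewrite /glue /coord /=; lra.
have fo : finfun o = o :> (edge G -> _) by apply/funext => e; rewrite ffunE.
exists (finfun o); rewrite fo; split=> //; rewrite /F vglue hy /glue /coord /=; split.
  by move=> v i; have /rowP/(_ i) := fl v; rewrite !summxE.
move=> e; have /andP[/N1 h1 /Nb h2] := hN e; split=> //.
by apply: h2; lra.
Qed.

(** The vector [u] turns a real nowhere-zero flow into an admissible vector flow, so some [r] exists
    and the minimum is attained. *)
Lemma NZF_inf_rat : bridgeless G ->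
  (exists u : 'rV[R]_d, forall t, N (t *: u) = `|t|) ->
  exists q : rat,
    ereal_inf [set r%:E | r in [set r : R | 2 <= r /\ has_NZF r]]%classic = (ratr q)%:E.
Proof.
move=> hG [u Nu].
have [r0 hr0] : exists r, 2 <= r /\ has_NZF r.
  have [o ho] := ex_orientation G; have [f [fn f1]] := nowhere_zero_flow_ge1 R ho hG.
  have S0 : 0 <= \sum_e `|f e| by apply: sumr_ge0.
  (* Makes [r - 1] exceed every [|f e|], and [r] at least 2. *)
  exists (2 + \sum_e `|f e|); split; first by lra.
  exists o, (fun e => f e *: u); split.
    split=> // v; rewrite -!scaler_suml; congr (_ *: _).
    by apply/eqP; rewrite -subr_eq0 -netE fn.
  move=> e; rewrite Nu f1 /=.
  have : `|f e| <= \sum_e `|f e| by rewrite [leRHS](bigD1 e) //= lerDl sumr_ge0.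
  by lra.
have [P sP hP] := semilin_NZF.
have [||||q [/hP qS qmin]] := @semilin_min R P coord 2 r0 _ _ sP.
- by [].
- by [].
- by move=> r /hP[r2 _]; rewrite ratr_nat.
- exact/hP.
exists q; apply/eqP; rewrite eq_le; apply/andP; split.
  by apply: ereal_inf_lbound; exists (ratr q).
by apply/ereal_infP => _ [r hr <-]; rewrite lee_fin; apply: qmin; apply/hP.
Qed.

End Rational.

Theorem theorem3 (R : realType) (G : graph) (d : nat)
    (hG : bridgeless G) (hd : (1 <= d)%N) :
  (exists q : rat, Phi_oo R d G = (ratr q)%:E) /\
  (exists q : rat, Phi1 R d G = (ratr q)%:E).
Proof.
(* As [d] is positive there is a first basis vector, and its multiple by [t] has norm [|t|] in both
   norms. *)
case: d hd => // d _; split.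
  apply: NZF_inf_rat (@polyhedral_norm_oo R d.+1) hG _.
  exists (delta_mx ord0 ord0) => t; apply/eqP; rewrite eq_le; apply/andP; split.
    apply: bigmax_le => // i _; rewrite !mxE eqxx /=.
    by case: eqP => _; rewrite ?mulr1 // mulr0 normr0.
  have := @le_bigmax _ R 'I_d.+1 0 (fun i => `|(t *: delta_mx ord0 ord0 : 'rV_d.+1) ord0 i|) ord0.
  by rewrite !mxE eqxx mulr1.
apply: NZF_inf_rat (@polyhedral_norm1 R d.+1) hG _.
exists (delta_mx ord0 ord0) => t; rewrite /norm1 (bigD1 ord0) //= !mxE eqxx mulr1.
rewrite big1 ?addr0 // => i /negbTE h; rewrite !mxE eqxx h mulr0 normr0 //.
Qed.
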